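(* Let $R$ be a commutative ring with non-zero identity, $M$ a Max-surjective unital $R$-module, and $T$ a non-empty subset of $\mathrm{Max}(M)$. Let $\Im(T)$ be the intersection of all members of $T$. Suppose $N$ and $L$ are adjacent in $G(\tau^{m}_{T})$. Then $J^{m}(N)/\Im(T)$ and $J^{m}(L)/\Im(T)$ are adjacent in $AG(M/\Im(T))$.
   Context: $\mathrm{Max}(M)$ is the set of maximal submodules of $M$. For $N\leq M$, $(N:M)=\{r\in R: rM\subseteq N\}$ and $V^{m}(N)=\{Q\in \mathrm{Max}(M):(Q:M)\supseteq (N:M)\}$. $J^{m}(N)$ is the intersection of all members of $V^{m}(N)$, with $J^m(N)=M$ if $V^m(N)=\emptyset$. $M$ is Max-surjective if either $M=0$, or $M\neq 0$ and the natural map $\mathrm{Max}(M)\to \mathrm{Max}(R/\mathrm{Ann}(M))$, $Q\mapsto (Q:M)/\mathrm{Ann}(M)$, is surjective. $G(\tau^{m}_{T})$ is the undirected graph whose vertices are the proper submodules $N<M$ for which there exists a proper submodule $L<M$ with $V^{m}(N)\cup V^{m}(L)=T$, $V^{m}(N)\neq T$ and $V^{m}(L)\neq T$; distinct vertices $N$ and $L$ are adjacent if and only if $V^{m}(N)\cup V^{m}(L)=T$. For submodules $N,K$ of an $R$-module $M'$, their product is $NK=(N:M')(K:M')M'$. The annihilating-submodule graph $AG(M')$ has as vertices the non-zero submodules $N\leq M'$ (possibly $N=M'$) for which there exists a non-zero proper submodule $K$ of $M'$ with $NK=0$; distinct vertices $N,L$ are adjacent if and only if $NL=0$. *)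

(* Defs.v *)
From HB Require Import structures.
From mathcomp Require Import all_boot all_algebra.
From mathcomp Require Import boolp classical_sets functions.

Set Implicit Arguments.
Unset Strict Implicit.
Unset Printing Implicit Defensive.

Import GRing.Theory.
Local Open Scope ring_scope.
Local Open Scope quotient_scope.
Local Open Scope classical_set_scope.

Record submodule (R : pzRingType) (M : lmodType R) := Submodule {
  submod_set :> set M;
  submod_closedP : submod_closed [in submod_set] }.

Notation "{ 'submod' M }" := (@submodule _ M%type)
  (at level 0, format "{ 'submod'  M }") : type_scope.

(* Ideals of a commutative ring R are the submodules of R^o, that is, of R
   acting on itself by multiplication. *)
Notation "{ 'ideal' R }" := (@submodule R R^o%type)
  (at level 0, format "{ 'ideal'  R }") : type_scope.

Section Submodules.
Context {R : pzRingType} {M : lmodType R}.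
Implicit Types (N K : {submod M}) (A : set M) (T : set {submod M}).

Lemma submod_inj N K : (N : set M) = K -> N = K.
Proof.
case: N K => [N hN] [K hK] /= eNK; rewrite {}eNK in hN *.
by congr Submodule; apply: Prop_irrelevance.
Qed.

Lemma submod_closed_set A :
  A 0 -> (forall a x y, A x -> A y -> A (a *: x + y)) -> submod_closed [in A].
Proof.
move=> A0 AL; split=> [|a x y /set_mem Ax /set_mem Ay]; first exact/mem_set.
exact/mem_set/AL.
Qed.

Lemma submod0 N : submod_set N 0.
Proof. by have [/set_mem] := submod_closedP N. Qed.

Lemma submodL N a x y :
  submod_set N x -> submod_set N y -> submod_set N (a *: x + y).
Proof.
have [_ NL] := submod_closedP N => Nx Ny.
by apply/set_mem/NL; apply/mem_set.
Qed.

Lemma submodZ N a x : submod_set N x -> submod_set N (a *: x).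
Proof. by move=> Nx; rewrite -(addr0 (a *: x)); apply: submodL (submod0 N). Qed.

Lemma bigcap_submod_closed T :
  submod_closed [in \bigcap_(Q in T) submod_set Q].
Proof.
apply: submod_closed_set => [Q _|a x y Tx Ty Q TQ]; first exact: submod0.
by apply: submodL; [apply: Tx | apply: Ty].
Qed.

(* The intersection of the empty family is the whole of M. *)
Definition bigcap_submod T : {submod M} := Submodule (bigcap_submod_closed T).

Lemma submodT_closed : submod_closed [in [set: M]].
Proof. by apply: submod_closed_set. Qed.

Definition submodT : {submod M} := Submodule submodT_closed.

Definition submod_span A : {submod M} := bigcap_submod [set N | A `<=` N].

Definition is_proper N : Prop := N <> [set: M] :> set M.

Definition is_zero N : Prop := N = [set 0] :> set M.

Definition is_maximal N : Prop :=
  is_proper N /\ forall K, is_proper K -> N `<=` K -> K = N.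

End Submodules.

Arguments submodT {R} M.

Definition Max {R : pzRingType} (M : lmodType R) : set {submod M} :=
  [set N | is_maximal N].

Arguments Max {R} M.

Section QuotientModule.
Context {R : pzRingType} {M : lmodType R}.

Definition mem_submod (N : {submod M}) : {pred M} := [in (N : set M)].

HB.instance Definition _ (N : {submod M}) :=
  GRing.isSubmodClosed.Build R M (mem_submod N) (submod_closedP N).

Definition quotmod (N : {submod M}) := Quotient.quot (mem_submod N).

Variable N : {submod M}.

HB.instance Definition _ := GRing.Zmodule.on (quotmod N).
HB.instance Definition _ := EqQuotient.on (quotmod N).
HB.instance Definition _ :=
  ZmodQuotient.copy (quotmod N) (Quotient.quot (mem_submod N)).

Lemma pi_eqP x y :
  \pi_(quotmod N) x = \pi_(quotmod N) y <-> submod_set N (x - y).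
Proof.
split=> [/eqP|Nxy]; last apply/eqP; rewrite -Quotient.idealrBE.
  exact/set_mem.
exact/mem_set.
Qed.

Definition scaleq (a : R) (x : quotmod N) : quotmod N :=
  \pi_(quotmod N) (a *: repr x).

Lemma pi_scale a x : \pi_(quotmod N) (a *: x) = scaleq a (\pi_(quotmod N) x).
Proof.
by apply/pi_eqP; rewrite -scalerBr; apply/submodZ/pi_eqP; rewrite reprK.
Qed.

Lemma scaleqA a b x : scaleq a (scaleq b x) = scaleq (a * b) x.
Proof. by rewrite -[x]reprK -(pi_scale b (repr x)) -!pi_scale scalerA. Qed.

Lemma scale1q : left_id 1 scaleq.
Proof. by move=> x; rewrite -[x]reprK -!pi_scale scale1r. Qed.

Lemma scaleqDr : right_distributive scaleq +%R.
Proof.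
by move=> a x y; rewrite -[x]reprK -[y]reprK -raddfD -!pi_scale scalerDr raddfD.
Qed.

Lemma scaleqDl x : {morph scaleq^~ x : a b / a + b}.
Proof. by move=> a b; rewrite -[x]reprK -!pi_scale scalerDl raddfD. Qed.

HB.instance Definition _ := GRing.Zmodule_isLmodule.Build R (quotmod N)
  scaleqA scale1q scaleqDr scaleqDl.

Lemma image_pi_submod_closed (K : {submod M}) :
  submod_closed [in \pi_(quotmod N) @` K].
Proof.
apply: submod_closed_set => [|a _ _ [x Kx <-] [y Ky <-]].
  by exists 0; [exact: submod0 | rewrite raddf0].
exists (a *: x + y); [exact: submodL |].
by rewrite raddfD; congr (_ + _); exact: pi_scale.
Qed.

(* K / N, the image of K in M / N. *)
Definition quot_submod (K : {submod M}) : {submod (quotmod N)} :=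
  Submodule (image_pi_submod_closed K).

End QuotientModule.

Section QuotientRing.
Context {R : comPzRingType}.

(* Contrary to {ideal_quot _}, I may be the whole of R. *)
Definition quotring (I : {ideal R}) := quotmod I.

Variable I : {ideal R}.

HB.instance Definition _ := GRing.Zmodule.on (quotring I).
HB.instance Definition _ := EqQuotient.on (quotring I).
HB.instance Definition _ := ZmodQuotient.copy (quotring I) (quotmod I).

Definition mulq (x y : quotring I) : quotring I := \pi_(quotring I) ((repr x : R) * repr y).

Lemma pi_mul (x y : R) :
  \pi_(quotring I) (x * y) = mulq (\pi_(quotring I) x) (\pi_(quotring I) y).
Proof.
apply/pi_eqP.
set x' : R := repr (\pi_(quotring I) x).
set y' : R := repr (\pi_(quotring I) y).
have -> : x * y - x' * y' = x *: (y - y' : R^o) + y' *: (x - x' : R^o) :> R^o.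
  by rewrite /GRing.scale /= !mulrBr [y' * x]mulrC [y' * x']mulrC addrA subrK.
by apply/submodL; [|apply: submodZ]; apply/pi_eqP; rewrite reprK.
Qed.

Lemma mulqA : associative mulq.
Proof.
move=> x y z; rewrite -[x]reprK -[y]reprK -[z]reprK.
by rewrite -(pi_mul (repr y)) -(pi_mul (repr x) (repr y)) -!pi_mul mulrA.
Qed.

Lemma mulqC : commutative mulq.
Proof. by move=> x y; rewrite -[x]reprK -[y]reprK -!pi_mul mulrC. Qed.

Lemma mul1q : left_id (\pi_(quotring I) (1 : R)) mulq.
Proof. by move=> x; rewrite -[x]reprK -!pi_mul mul1r. Qed.

Lemma mulqDl : left_distributive mulq +%R.
Proof.
move=> x y z; rewrite -[x]reprK -[y]reprK -[z]reprK -raddfD -!pi_mul.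
by rewrite -raddfD mulrDl.
Qed.

HB.instance Definition _ := GRing.Zmodule_isComPzRing.Build (quotring I)
  mulqA mulqC mul1q mulqDl.

Lemma image_pi_ideal_closed (J : {ideal R}) :
  submod_closed ([in \pi_(quotring I) @` J] : {pred (quotring I)^o}).
Proof.
apply: submod_closed_set => [|a _ _ [x Jx <-] [y Jy <-]].
  by exists 0; [exact: submod0 | rewrite raddf0].
exists ((repr a : R) *: x + y); first exact: submodL.
by rewrite raddfD /= -[a in RHS]reprK; congr (_ + _); exact: pi_mul.
Qed.

(* J / I, the image of J in R / I. *)
Definition quot_ideal (J : {ideal R}) : {ideal (quotring I)} :=
  Submodule (image_pi_ideal_closed J).

End QuotientRing.

Section Colon.
Context {R : comPzRingType} {M : lmodType R}.
Implicit Types (N K Q : {submod M}) (T : set {submod M}).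

Lemma colon_closed N :
  submod_closed ([in [set r | forall x : M, submod_set N (r *: x)]]
                 : {pred R^o}).
Proof.
apply: submod_closed_set => [x|a r s Nr Ns x].
  by rewrite scale0r; exact: submod0.
by rewrite scalerDl -scalerA; apply: submodL.
Qed.

(* (N : M) *)
Definition colon N : {ideal R} := Submodule (colon_closed N).

Lemma Ann_closed :
  submod_closed ([in [set r | forall x : M, r *: x = 0]] : {pred R^o}).
Proof.
apply: submod_closed_set => [x|a r s r0 s0 x]; first by rewrite scale0r.
by rewrite scalerDl -scalerA r0 s0 scaler0 addr0.
Qed.

Definition Ann : {ideal R} := Submodule Ann_closed.

(* V^m(N), J^m(N) and \Im(T) *)
Definition Vm N : set {submod M} :=
  [set Q | Max M Q /\ colon N `<=` colon Q].

Definition Jm N : {submod M} := bigcap_submod (Vm N).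

Definition frakI T : {submod M} := bigcap_submod T.

(* I M is the submodule generated by the products r x; the product of two
   ideals is the case M = R^o. *)
Definition ideal_mul (I : {ideal R}) N : {submod M} :=
  submod_span
    [set y | exists r x, [/\ submod_set I r, submod_set N x & y = r *: x]].

(* the graph G(tau^m_T) *)
Definition Gtau_vertex T N : Prop :=
  is_proper N /\
  exists L, [/\ is_proper L, Vm N `|` Vm L = T, Vm N <> T & Vm L <> T].

Definition Gtau_adjacent T N L : Prop :=
  [/\ Gtau_vertex T N, Gtau_vertex T L, N <> L & Vm N `|` Vm L = T].

End Colon.

Arguments Ann {R} M.

(* The natural map Q |-> (Q : M) / Ann(M) from Max(M) to Max(R / Ann(M)) is
   surjective if M is nonzero. *)
Definition Max_surjective {R : comPzRingType} (M : lmodType R) : Prop :=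
  (forall x : M, x = 0) \/
  (exists x : M, x <> 0) /\
  set_surj (Max M) (Max (quotring (Ann M))^o)
    (fun Q : {submod M} => quot_ideal (Ann M) (colon Q)).

Section AnnihilatingSubmoduleGraph.
Context {R : comPzRingType} {M : lmodType R}.
Implicit Types N K L : {submod M}.

(* (N : M)(K : M)M *)
Definition submod_mul N K : {submod M} :=
  ideal_mul (ideal_mul (colon N) (colon K)) (submodT M).

(* the graph AG(M) *)
Definition AG_vertex N : Prop :=
  ~ is_zero N /\
  exists K, [/\ ~ is_zero K, is_proper K & is_zero (submod_mul N K)].

Definition AG_adjacent N L : Prop :=
  [/\ AG_vertex N, AG_vertex L, N <> L & is_zero (submod_mul N L)].

End AnnihilatingSubmoduleGraph.

(* Main.v *)
Require Import Defs.
From mathcomp Require Import all_boot all_algebra.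
From mathcomp Require Import boolp classical_sets functions.

(** The product of [J^m(N)/I] and [J^m(L)/I], where [I = \Im(T)], vanishes
    because [J^m(N)] and [J^m(L)] meet in the intersection of [V^m(N) U V^m(L) =
    T], that is, in [I].  If [J^m(N)] were contained in [I], every [Q] in [T]
    would contain [J^m(N)], so [(Q : M)] would contain [(N : M)], giving
    [V^m(N) = T]; hence both quotients are nonzero, and they are distinct since
    their intersection is zero.  They are proper because an empty [V^m(N)] would
    give [V^m(L) = T]. *)

Import GRing.Theory.
Local Open Scope ring_scope.
Local Open Scope quotient_scope.
Local Open Scope classical_set_scope.

Lemma ideal_mul_subset {R : comPzRingType} {M : lmodType R}
    (J : {ideal R}) (N K : {submod M}) :
  (forall r x, submod_set J r -> submod_set N x -> submod_set K (r *: x)) ->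
  ideal_mul J N `<=` K.
Proof. by move=> JNK z; apply=> _ [r [x [Jr Nx ->]]]; apply: JNK. Qed.

(** The ideal product of the two colon ideals lies in each of them, and an element of [colon N]
    sends all of [M] into [N]. *)
Lemma submod_mul_subset {R : comPzRingType} {M : lmodType R}
    (N K : {submod M}) : submod_mul N K `<=` N `&` K.
Proof.
rewrite subsetI; split; apply: ideal_mul_subset => r x NKr _.
- suff /(_ _ NKr) : ideal_mul (colon N) (colon K) `<=` colon N by apply.
  apply: ideal_mul_subset => a b Na _.
  (* Scaling in [R^o] is multiplication, so commutativity turns [a *: b] into a multiple of [a]. *)
  by rewrite [a *: b]mulrC; exact: (@submodZ _ _ (colon N) b a Na).
- suff /(_ _ NKr) : ideal_mul (colon N) (colon K) `<=` colon K by apply.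
  by apply: ideal_mul_subset => a b _; exact: submodZ.
Qed.

Section QuotientSubmodules.
Context {R : comPzRingType} {M : lmodType R}.
Implicit Types (I N K : {submod M}).

Lemma submodB N x y : submod_set N x -> submod_set N y -> submod_set N (x - y).
Proof. by move=> Nx Ny; rewrite addrC -scaleN1r; apply: submodL. Qed.

Lemma quot_submodE I N (x : M) : I `<=` N ->
  submod_set (quot_submod I N) (\pi_(quotmod I) x) <-> submod_set N x.
Proof.
move=> IN; split=> [[y Ny /pi_eqP Iyx]|Nx]; last by exists x.
(* Here [x = y - (y - x)], with [y - x] in [I] and hence in [N]. *)
by rewrite -(subKr y x); apply: submodB => //; apply: IN.
Qed.

Lemma quot_submod_inj I N K : I `<=` N -> I `<=` K ->
  quot_submod I N = quot_submod I K -> N = K.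
Proof.
move=> IN IK eNK; apply/submod_inj/seteqP.
by split=> x; rewrite -(quot_submodE _ _ x IN) -(quot_submodE _ _ x IK) eNK.
Qed.

Lemma quot_submod_zero I N : is_zero (quot_submod I N) -> N `<=` I.
Proof.
move=> N0 x Nx.
have : submod_set (quot_submod I N) (\pi_(quotmod I) x) by exists x.
rewrite [submod_set _]N0 /= -[RHS](raddf0 \pi_(quotmod I)) => /pi_eqP.
by rewrite subr0.
Qed.

Lemma quot_submod_proper I N :
  I `<=` N -> is_proper N -> is_proper (quot_submod I N).
Proof.
move=> IN Npr NIT; apply: Npr; apply/seteqP; split=> // x _.
by apply/(quot_submodE _ _ x IN); rewrite [submod_set _]NIT.
Qed.

(** A product lies in both of its factors; since [N] and [K] contain [I], a class in both quotients
    has its representative in [N] and in [K], hence in [I]. *)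
Lemma submod_mul_quot_zero I N K : I `<=` N -> I `<=` K -> N `&` K `<=` I ->
  is_zero (submod_mul (quot_submod I N) (quot_submod I K)).
Proof.
move=> IN IK NKI; apply/seteqP; split=> [z /submod_mul_subset[] | _ ->].
  rewrite -[z]reprK => /(quot_submodE _ _ _ IN) Nz /(quot_submodE _ _ _ IK) Kz.
  rewrite /= -[RHS](raddf0 \pi_(quotmod I)).
  by apply/pi_eqP; rewrite subr0; apply: NKI.
exact: submod0.
Qed.

End QuotientSubmodules.

Section MaximalVariety.
Context {R : comPzRingType} {M : lmodType R}.
Implicit Types (N L : {submod M}) (T : set {submod M}).

Lemma frakI_subset_Jm T N : Vm N `<=` T -> frakI T `<=` Jm N.
Proof. by move=> VT x Ix Q /VT; apply: Ix. Qed.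

Lemma Jm_subset_frakI T N :
  T `<=` Max M -> Jm N `<=` frakI T -> T `<=` Vm N.
Proof.
move=> Tmax JI Q TQ; split=> [|r Nr x]; first exact: Tmax.
(* For [r] in [colon N], [r *: x] lies in every [P] of [Vm N], hence in [Jm N] and so in [Q]. *)
by apply: (JI _ _ Q TQ) => P [_]; apply.
Qed.

Lemma JmI N L : Jm N `&` Jm L `<=` frakI (Vm N `|` Vm L).
Proof. by move=> x [Nx Lx] Q [/Nx|/Lx]. Qed.

Lemma Jm_proper N : Vm N !=set0 -> is_proper (Jm N).
Proof.
move=> [Q VQ] JT; have [[Qpr _] _] := VQ.
apply: Qpr; apply/seteqP; split=> // x _.
have : submod_set (Jm N) x by rewrite [submod_set _]JT.
exact.
Qed.

Lemma quot_Jm_neq0 T N : T `<=` Max M -> Vm N `<=` T -> Vm N <> T ->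
  ~ is_zero (quot_submod (frakI T) (Jm N)).
Proof.
move=> Tmax VT VneT /quot_submod_zero JI; apply: VneT.
by apply/seteqP; split=> //; exact: Jm_subset_frakI.
Qed.

Lemma AG_vertex_quot_Jm T N L : T `<=` Max M ->
  Vm N `|` Vm L = T -> Vm N <> T -> Vm L <> T ->
  AG_vertex (quot_submod (frakI T) (Jm N)).
Proof.
move=> Tmax VT VNT VLT.
have NT : Vm N `<=` T by rewrite -VT; exact: subsetUl.
have LT : Vm L `<=` T by rewrite -VT; exact: subsetUr.
split; first exact: quot_Jm_neq0.
(* The other endpoint of the edge serves as the annihilating witness. *)
exists (quot_submod (frakI T) (Jm L)); split; first exact: quot_Jm_neq0.
  apply: quot_submod_proper; first exact: frakI_subset_Jm.
  apply: Jm_proper; apply/set0P/eqP => VL0; apply: VNT.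
  by rewrite -VT VL0 setU0.
apply: submod_mul_quot_zero; try exact: frakI_subset_Jm.
by rewrite -VT; exact: JmI.
Qed.

End MaximalVariety.

Theorem corollary4p2 (R : comNzRingType) (M : lmodType R)
    (T : set {submod M}) (N L : {submod M}) :
  Max_surjective M -> T `<=` Max M -> T !=set0 ->
  Gtau_adjacent T N L ->
  AG_adjacent (quot_submod (frakI T) (Jm N)) (quot_submod (frakI T) (Jm L)).
Proof.
move=> _ Tmax _ [[_ [N' [_ _ VNT _]]] [_ [L' [_ _ VLT _]]] _ VT].
have NT : Vm N `<=` T by rewrite -VT; exact: subsetUl.
have LT : Vm L `<=` T by rewrite -VT; exact: subsetUr.
have JNL : Jm N `&` Jm L `<=` frakI T by rewrite -VT; exact: JmI.
split.
- exact: AG_vertex_quot_Jm VT VNT VLT.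
- by rewrite setUC in VT; exact: AG_vertex_quot_Jm VT VLT VNT.
- move=> /quot_submod_inj eJ; apply: VNT; apply/seteqP; split=> //.
  (* If [Jm N = Jm L], their intersection is [Jm N] itself, so [JNL] puts it inside [frakI T]. *)
  apply: Jm_subset_frakI => //; rewrite -eJ ?setIid in JNL => //;
    exact: frakI_subset_Jm.
- by apply: submod_mul_quot_zero => //; exact: frakI_subset_Jm.
Qed.
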